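(* Let $G=(V,E)$ be a strongly connected digraph that has a good decomposition $C_1,\dots,C_N$ with witness set $F$, such that every vertex has indegree at most $2$ and outdegree at most $2$, and such that $G$ satisfies the good tours property. Let $G^{new}=(V^{new},E^{new})$ be the digraph obtained from $G$ by the splitting operation. Then for every integer $t\ge 0$ and every $Q\subseteq F$ with $|Q|\le |F|-(t+2)$, we have $z^{Q,t}\in SA^t(P)$, where $P$ is the cone of the DFJ polytope of $G^{new}$.
   Context: Good decomposition: a strongly connected digraph $G=(V,E)$ has a good decomposition with witness set $F$ if $E$ is partitioned into edge-disjoint dicycles $C_1,\dots,C_N$ (so $E=\bigcup_j E(C_j)$), and $F$ is a nonempty subset of $\{1,\dots,N\}$ such that $G-E(C_j)$ is strongly connected for every $j\in F$. Splitting operation: for each vertex $v$ of $G$ with indegree $=$ outdegree $=2$, exactly two of the dicycles pass through $v$; label them $C_i,C_j$ (in a fixed but arbitrary way) and let $e_{i1}=(a,v),e_{i2}=(v,b)$ be the edges of $C_i$ at $v$ and $e_{j1}=(c,v),e_{j2}=(v,d)$ those of $C_j$. Replace $v$ by two new vertices $v^u,v^b$; replace $e_{i1}$ by $(a,v^u)$, $e_{j2}$ by $(v^u,d)$, $e_{i2}$ by $(v^b,b)$, $e_{j1}$ by $(c,v^b)$ (these are ''solid'' edges), and add the two auxiliary (''dashed'') edges $(v^b,v^u)$ and $(v^u,v^b)$. Doing this at all such vertices gives $G^{new}=(V^{new},E^{new})$. Let $E_s$ be the set of solid edges (images of edges of $G$) and $D$ the set of dashed edges. For each $j$, $E(C_j)$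 also denotes the set of images in $G^{new}$ of the edges of $C_j$, and $D(C_j)$ is the set consisting of, for each split vertex $v$ on $C_j$, the dashed edge at $\{v^u,v^b\}$ whose head equals the head of the image of the edge of $C_j$ entering $v$ (so $(v^b,v^u)\in D(C_i)$ and $(v^u,v^b)\in D(C_j)$ above). Thus $E^{new}$ is the disjoint union of the sets $E(C_j)\cup D(C_j)$. For $j\in F$: $\mathrm{tour}(j)=D(C_j)\cup\bigcup_{i\ne j}E(C_i)$. $G$ has the good tours property if $\mathrm{tour}(j)$ is the edge set of a Hamiltonian dicycle of $G^{new}$ for every $j\in F$. DFJ polytope of a digraph $G'=(V',E')$: the set of $x\in\mathbb{R}^{E'}$ with $x(\delta^{in}(S))\ge1$, $x(\delta^{out}(S))\ge1$ for all $\emptyset\subsetneq S\subsetneq V'$, $x(\delta^{in}(\{v\}))=x(\delta^{out}(\{v\}))=1$ for all $v\in V'$, $0\le x\le 1$ ($\delta^{in},\delta^{out}$ = entering/leaving edges of $G'$, $x(A)=\sum_{e\in A}x_e$). Its cone is $\{\lambda(1,x):\lambda\ge0,\ x\text{ in the polytope}\}$, i.e. the set of $(x_0,x)$ satisfying the homogenized constraints $\sum a_ix_i\ge b x_0$. Sherali–Adams for a cone: if $\hat P\subseteq[0,1]^n$ is described by inequalities $\sum_i a_iy_i\ge b$ (including $0\le y_i\le1$, equations as two inequalities) and $P$ is its cone, $SA^t(P)$ is the set of vectors $y=(y_S)$ indexed by subsets $S\subseteq\{1,\dots,n\}$ with $|S|\le t+1$ (including $S=\emptyset$) such that for every inequality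 and every pair of disjoint $S,Q'$ with $|S|+|Q'|\le t$: $\sum_i a_i\sum_{T\subseteq Q'}(-1)^{|T|}y_{S\cup T\cup\{i\}}\ge b\sum_{T\subseteq Q'}(-1)^{|T|}y_{S\cup T}$. (Adding $y_\emptyset=1$ gives the level-$t$ tightening of $\hat P$.) The vector $z^{Q,t}$: for $S\subseteq E^{new}$ with $|S|\le t+1$, let $g_Q(S)$ be the number of indices $j\in F-Q$ with $E(C_j)\cap S\ne\emptyset$. Then $z^{Q,t}_S=\frac{t+2-g_Q(S)}{t+2}$ if $S\cap D=\emptyset$; $z^{Q,t}_S=\frac{1}{t+2}$ if $S\cap D\neq\emptyset$ and there is $i\in F-Q$ with $S\subseteq\mathrm{tour}(i)$; and $z^{Q,t}_S=0$ otherwise. *)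

(* Defs.v *)
From mathcomp Require Import all_boot all_order all_algebra.

Set Implicit Arguments.
Unset Strict Implicit.
Unset Printing Implicit Defensive.

Import Order.TTheory GRing.Theory Num.Theory.

(* Edges are abstract objects with endpoints rather than pairs of vertices, so
   parallel edges and loops are allowed; a digraph whose edges are ordered
   pairs of vertices is the special case where [src] and [tgt] are the two
   projections. *)
Record digraph := Digraph {
  vert : finType;
  edge : finType;
  src : edge -> vert;
  tgt : edge -> vert }.

Section Digraph.
Variable G : digraph.
Implicit Types (v : vert G) (e : edge G) (S : {set vert G}) (A : {set edge G}).

Definition indegree v := #|[set e | tgt e == v]|.
Definition outdegree v := #|[set e | src e == v]|.

Definition delta_in S : {set edge G} :=
  [set e | (src e \notin S) && (tgt e \in S)].
Definition delta_out S : {set edge G} :=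
  [set e | (src e \in S) && (tgt e \notin S)].

Definition strongly_connected : Prop :=
  forall u v, connect [rel x y | [exists e, (src e == x) && (tgt e == y)]] u v.

Definition del_edges A : digraph :=
  @Digraph (vert G) {e : edge G | e \notin A}
    (fun e : {e : edge G | e \notin A} => src (val e))
    (fun e : {e : edge G | e \notin A} => tgt (val e)).

(* [p] lists the edges in cyclic order; the starting vertices of the edges are
   exactly the vertices visited. *)
Definition dicycle_seq (p : seq (edge G)) : bool :=
  [&& p != [::], cycle (fun e f => tgt e == src f) p & uniq (map (@src G) p)].

Definition dicycle A : Prop :=
  exists2 p, dicycle_seq p & A = [set e in p].

Definition hamiltonian_dicycle A : Prop :=
  exists p, [/\ dicycle_seq p, A = [set e in p]
              & forall v, v \in map (@src G) p].

End Digraph.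

Definition good_decomposition (G : digraph) N (C : 'I_N -> {set edge G}) (F : {set 'I_N})
    : Prop :=
  [/\ forall j, dicycle (C j),
      forall i j, i != j -> [disjoint C i & C j],
      \bigcup_j C j = [set: edge G],
      F != set0
    & forall j, j \in F -> strongly_connected (del_edges (C j))].

Definition split_vertex (G : digraph) (v : vert G) :=
  (indegree v == 2) && (outdegree v == 2).

Section Splitting.
Variables (G : digraph) (N : nat) (C : 'I_N -> {set edge G}).

(* [lab v] is the dicycle that plays the role of C_i at the split vertex v (the
   other dicycle through v being C_j); its values at the vertices that are not
   split are irrelevant. *)
Definition labelling (lab : vert G -> 'I_N) : Prop :=
  forall v, split_vertex v -> exists2 e, e \in C (lab v) & tgt e = v.

Variable lab : vert G -> 'I_N.

(* For a split vertex v, (v, true) is v^u and (v, false) is v^b; a vertex v that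
   is not split survives as (v, false). *)
Definition new_vert :=
  {x : vert G * bool | split_vertex x.1 || ~~ x.2}.

Lemma copy_subproof (v : vert G) (b : bool) :
  split_vertex (v, split_vertex v && b).1 || ~~ (v, split_vertex v && b).2.
Proof. by rewrite /=; case: (split_vertex v). Qed.

(* v^u or v^b, according to [b], if v is split, and v itself otherwise. *)
Definition copy (v : vert G) (b : bool) : new_vert :=
  exist _ (v, split_vertex v && b) (copy_subproof v b).

(* [inl e] is the (solid) image of the edge e of G; [inr (v, true)] and
   [inr (v, false)] are the dashed edges (v^b, v^u) and (v^u, v^b). *)
Definition new_edge := (edge G + {v : vert G | split_vertex v} * bool)%type.

Definition new_src (x : new_edge) : new_vert :=
  match x with
  | inl e => copy (src e) (e \notin C (lab (src e)))
  | inr (w, b) => copy (val w) (~~ b)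
  end.

Definition new_tgt (x : new_edge) : new_vert :=
  match x with
  | inl e => copy (tgt e) (e \in C (lab (tgt e)))
  | inr (w, b) => copy (val w) b
  end.

Definition Gnew : digraph := @Digraph new_vert new_edge new_src new_tgt.

Definition image (A : {set edge G}) : {set edge Gnew} :=
  [set (inl e : new_edge) | e in A].

Definition dashed : {set edge Gnew} :=
  [set (inr w : new_edge) | w in [set: {v : vert G | split_vertex v} * bool]].

Definition dashed_of (j : 'I_N) : {set edge Gnew} :=
  [set (inr w : new_edge) | w in
     [set w : {v : vert G | split_vertex v} * bool |
        [exists e in C j, (tgt e == val w.1)
                       && (new_tgt (inl e) == new_tgt (inr w))]]].

Definition tour (j : 'I_N) : {set edge Gnew} :=
  dashed_of j :|: \bigcup_(i | i != j) image (C i).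

Definition good_tours (F : {set 'I_N}) : Prop :=
  forall j, j \in F -> hamiltonian_dicycle (tour j).

End Splitting.

Local Open Scope ring_scope.

Section SheraliAdams.
Variables (R : realFieldType) (I : finType).

(* A system of linear inequalities over R^I, as the set of pairs (a, b) that
   stand for the inequalities \sum_i a_i x_i >= b. *)
Definition system := (I -> R) -> R -> Prop.

Definition cone (P : system) (x0 : R) (x : I -> R) : Prop :=
  forall a b, P a b -> \sum_i a i * x i >= b * x0.

(* The tightening depends on the system and not only on its solution set.
   Vectors are total functions on {set I}, but only the entries y S with
   #|S| <= t + 1 are constrained. *)
Definition SA (t : nat) (P : system) (y : {set I} -> R) : Prop :=
  forall S Q : {set I}, [disjoint S & Q] -> (#|S| + #|Q| <= t)%N ->
    cone P (\sum_(T in powerset Q) (-1) ^+ #|T| * y (S :|: T))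
           (fun i => \sum_(T in powerset Q) (-1) ^+ #|T| * y (S :|: T :|: [set i])).

End SheraliAdams.

Section DFJ.
Variables (R : realFieldType) (G : digraph).

Definition indic (A : {set edge G}) : edge G -> R := fun e => (e \in A)%:R.

Inductive dfj : system R (edge G) :=
| dfj_cut_in S of S != set0 & S != [set: vert G] :
    dfj (indic (delta_in S)) 1
| dfj_cut_out S of S != set0 & S != [set: vert G] :
    dfj (indic (delta_out S)) 1
| dfj_in_ge v : dfj (indic (delta_in [set v])) 1
| dfj_in_le v : dfj (fun e => - indic (delta_in [set v]) e) (-1)
| dfj_out_ge v : dfj (indic (delta_out [set v])) 1
| dfj_out_le v : dfj (fun e => - indic (delta_out [set v]) e) (-1)
| dfj_ge0 e : dfj (indic [set e]) 0
| dfj_le1 e : dfj (fun f => - indic [set e] f) (-1).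

End DFJ.

Arguments dfj R G : clear implicits.

Section ZVector.
Variables (R : realFieldType) (G : digraph) (N : nat).
Variables (C : 'I_N -> {set edge G}) (F : {set 'I_N}) (lab : vert G -> 'I_N).
Variables (Q : {set 'I_N}) (t : nat).

Definition g_count (S : {set edge (Gnew C lab)}) : nat :=
  #|[set j in F :\: Q | image C lab (C j) :&: S != set0]|.

Definition z_vec (S : {set edge (Gnew C lab)}) : R :=
  if S :&: dashed C lab == set0 then
    (t.+2%:R - (g_count S)%:R) / t.+2%:R
  else if [exists i in F :\: Q, S \subset tour C lab i] then t.+2%:R^-1
  else 0.

End ZVector.

Arguments z_vec R {G N} C F lab Q t S.

(* Main.v *)
(* Every edge of Gnew lies in E(C_j) :|: D(C_j) for at most one j.  Let W be any
   set of t+2 indices in F :\: Q containing all indices in F :\: Q that occur in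
   X; then z_X is the fraction of the tours j in W that contain X.  By
   inclusion-exclusion, on the coordinates e whose index lies in W, the vector
   obtained by conditioning on S and Q' is a nonnegative combination of tours.
   Since S and Q' use at most t indices, this settles every inequality whose
   support uses at most two further indices: the bounds, and the upper degree
   constraints because all degrees are at most 2.
     A cut A meets every tour, and since all coordinates are nonnegative it
   suffices to find a part of A that meets the tours of some admissible W and
   only uses indices of W.  If A contains a solid edge e, then e belongs to all
   tours but possibly one, tour k, and {e, f} with f an edge of A on tour k will
   do.  If A is all dashed, take its edges with index in W. *)

Require Import Defs.
From mathcomp Require Import all_boot all_order all_algebra.

Set Implicit Arguments.
Unset Strict Implicit.
Unset Printing Implicit Defensive.

Import Order.TTheory GRing.Theory Num.Theory.

(** * Finite sets: interpolation, unions and inclusion-exclusion *)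

Section FinsetLemmas.
Variable T : finType.
Implicit Types A B : {set T}.

Lemma intermediate_set A B m : A \subset B -> #|A| <= m <= #|B| ->
  exists W : {set T}, [/\ A \subset W, W \subset B & #|W| = m].
Proof.
move=> sAB /andP[leAm lemB]; rewrite -(subnKC leAm) in lemB *.
elim: (m - #|A|) lemB => [|k IHk] lekB.
  by exists A; rewrite addn0.
have [|W [sAW sWB cardW]] := IHk.
  by apply: leq_trans lekB; rewrite leq_add2l.
have /properP[_ [x Bx W'x]] : W \proper B.
  by rewrite properEcard sWB cardW -addnS.
exists (x |: W); split.
- exact: subset_trans sAW (subsetUr _ _).
- by rewrite subUset sub1set Bx.
- by rewrite cardsU1 W'x cardW addnS.
Qed.

Lemma card_bigcup_le1 (J : finType) (D : {set J}) (B : J -> {set T}) :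
  (forall j, j \in D -> #|B j| <= 1) -> #|\bigcup_(j in D) B j| <= #|D|.
Proof.
move=> leB1; rewrite -(sum1_card (mem D)).
apply: (big_ind2 (fun (X : {set T}) n => #|X| <= n)) => //.
- by rewrite cards0.
- move=> X1 n1 X2 n2 le1 le2.
  by apply: leq_trans (leq_card_setU X1 X2) _; apply: leq_add.
Qed.

Local Open Scope ring_scope.

(** Inclusion-exclusion, obtained by expanding the product over [i] of one minus the indicator of
    [A :&: B] at [i]. *)
Lemma alternating_sum_subsets (R : comNzRingType) A B :
  \sum_(X in powerset A) (-1) ^+ #|X| * (X \subset B)%:R
    = [disjoint A & B]%:R :> R.
Proof.
have -> : [disjoint A & B]%:R = \prod_i (- (i \in A :&: B)%:R + 1) :> R.
  rewrite -setI_eq0; case: (set_0Vmem (A :&: B)) => [-> | [x ABx]].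
    by rewrite eqxx big1 // => i _; rewrite inE oppr0 add0r.
  have /negPf-> : A :&: B != set0 by apply/set0Pn; exists x.
  by rewrite (bigD1 x) //= ABx addNr mul0r.
rewrite bigA_distr [LHS]big_mkcond /=; apply: eq_bigr => X _.
rewrite powersetE -[RHS]big_mkcond /= prodrN.
have [sX|nsX] := boolP (X \subset A :&: B).
  move: (sX); rewrite subsetI => /andP[-> ->].
  by rewrite big1 // => i /(subsetP sX) ->.
have [x Xx ABx] := subsetPn nsX.
have -> : \prod_(i in X) (i \in A :&: B)%:R = 0 :> R.
  by rewrite (bigD1 x) //= (negPf ABx) mul0r.
by move: nsX; rewrite subsetI; do 2!case: (_ \subset _); rewrite ?mulr0.
Qed.

End FinsetLemmas.

(** * Sherali-Adams rows as local averages over an abstract family of tours *)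

Section TourAverages.
Local Open Scope ring_scope.
Variables (R : realFieldType) (I K : finType).
Variables (cls : I -> {set K}) (tr : K -> {set I}) (D : {set I}).
Hypothesis card_cls : forall x, (#|cls x| <= 1)%N.
Hypothesis tr_solid : forall x j, x \notin D -> (x \in tr j) = (j \notin cls x).
Hypothesis tr_dashed : forall x j, x \in D -> (x \in tr j) = (j \in cls x).
Variables (F : {set K}) (t : nat).
Hypothesis cardF : (t.+2 <= #|F|)%N.

Definition classes (X : {set I}) : {set K} := \bigcup_(x in X) cls x.

Lemma classesU (X Y : {set I}) : classes (X :|: Y) = classes X :|: classes Y.
Proof. exact: bigcup_setU. Qed.

Lemma classesS (X Y : {set I}) : X \subset Y -> classes X \subset classes Y.
Proof. by move=> /setUidPr <-; rewrite classesU subsetUl. Qed.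

Lemma classes1 x : classes [set x] = cls x.
Proof. exact: big_set1. Qed.

Lemma card_classes (X : {set I}) : (#|classes X| <= #|X|)%N.
Proof. exact: card_bigcup_le1. Qed.

(* [z_vec] for an abstract family of tours, where [D] is the set of dashed edges
   and [cls x] holds the index j with x in E(C_j) :|: D(C_j), if any. *)
Definition tour_vec (X : {set I}) : R :=
  if X :&: D == set0 then (t.+2%:R - #|F :&: classes X|%:R) / t.+2%:R
  else if [exists i in F, X \subset tr i] then t.+2%:R^-1 else 0.

(** If [X] is all solid, the tours in [W] that miss part of [X] are those indexed by [classes X],
    and [W] and [F] contain the same such indices. If [X] has a dashed edge, only the tour of its
    unique class can contain [X], and that class lies in [W] as soon as it lies in [F]. *)
Lemma local_average (W : {set K}) X :
  W \subset F -> #|W| = t.+2 -> F :&: classes X \subset W ->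
  tour_vec X = t.+2%:R^-1 * \sum_(j in W) (X \subset tr j)%:R.
Proof.
move=> sWF cardW sXW; rewrite /tour_vec.
case: (set_0Vmem (X :&: D)) => [XD0 | [x]].
  rewrite XD0 eqxx mulrC; congr (_ * _).
  have trX j : (X \subset tr j) = (j \notin classes X).
    have solid x : x \in X -> x \notin D.
      by move=> Xx; apply/negP => Dx; move/setP/(_ x): XD0; rewrite !inE Xx Dx.
    apply/subsetP/negP => [sX /bigcupP[x Xx] | nX x Xx].
      by apply/negP; rewrite -tr_solid ?sX ?solid.
    rewrite tr_solid ?solid //; apply/negP => clsx.
    by apply: nX; apply/bigcupP; exists x.
  have <- : W :&: classes X = F :&: classes X.
    apply/eqP; rewrite eqEsubset setSI //=.
    by rewrite subsetI sXW subsetIr.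
  rewrite -natr_sum -cardW -(cardsID (classes X) W) natrD addrAC subrr add0r.
  rewrite -sum1_card; congr _%:R.
  rewrite [RHS](eq_bigr (fun j => if j \notin classes X then 1 else 0))%N; last first.
    by move=> j _; rewrite trX; case: (_ \notin _).
  by rewrite -big_mkcondr /=; apply: eq_bigl => j; rewrite !inE andbC.
rewrite inE => /andP[Xx Dx].
have /negPf-> : X :&: D != set0 by apply/set0Pn; exists x; rewrite inE Xx.
have cls_tr j : X \subset tr j -> j \in cls x.
  by move=> /subsetP/(_ x Xx); rewrite tr_dashed.
case: existsP => [[i /andP[Fi sXi]] | noi].
  have Wi : i \in W.
    apply: (subsetP sXW); rewrite inE Fi /=; apply/bigcupP.
    by exists x => //; apply: cls_tr.
  rewrite (bigD1 i) //= sXi big1 ?addr0 ?mulr1 // => j /andP[_ neji].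
  case: (boolP (X \subset tr j)) => // sXj.
  by rewrite (card_le1_eqP (card_cls x) i j) ?eqxx ?cls_tr // in neji.
rewrite big1 ?mulr0 // => j Wj; case: (boolP (X \subset tr j)) => // sXj.
by case: noi; exists j; rewrite (subsetP sWF).
Qed.

Section Row.
Variables S Q : {set I}.
Hypothesis cardSQ : (#|S| + #|Q| <= t)%N.

(** The vector conditioned on [S] being present and [Q] absent, without normalization: [U = set0]
    gives the homogenizing coordinate and [U = [set x]] the coordinate of [x]. *)
Definition sa_row (U : {set I}) : R :=
  \sum_(T in powerset Q) (-1) ^+ #|T| * tour_vec (S :|: T :|: U).

Definition hits (j : K) : R := ((S \subset tr j) && [disjoint Q & tr j])%:R.

(** A single [W] serves all terms of the row, since the classes of [S :|: T :|: U] with [T] inside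
    [Q] are among those of [S :|: Q :|: U]. The alternating sum over [T] then keeps exactly the
    tours that contain [S] and avoid [Q]. *)
Lemma sa_row_average (W : {set K}) U :
  W \subset F -> #|W| = t.+2 -> F :&: classes (S :|: Q :|: U) \subset W ->
  sa_row U = t.+2%:R^-1 * \sum_(j in W) hits j * (U \subset tr j)%:R.
Proof.
move=> sWF cardW sW; rewrite /sa_row.
under eq_bigr => T sTQ.
  rewrite (local_average sWF cardW); last first.
    apply: subset_trans sW; apply: setIS; apply: classesS.
    by rewrite setSU // setUS // -powersetE.
  rewrite mulrCA mulr_sumr; over.
rewrite -mulr_sumr exchange_big /=; congr (_ * _); apply: eq_bigr => j _.
have splitU T : (S :|: T :|: U \subset tr j)%:R
    = (S \subset tr j)%:R * (U \subset tr j)%:R * (T \subset tr j)%:R :> R.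
  by rewrite !subUset -!mulnb !natrM mulrAC.
under eq_bigr => T _ do rewrite splitU mulrCA.
by rewrite -mulr_sumr alternating_sum_subsets mulrAC /hits -mulnb natrM.
Qed.

Lemma sa_row_set0 :
  sa_row set0 = \sum_(T in powerset Q) (-1) ^+ #|T| * tour_vec (S :|: T).
Proof. by apply: eq_bigr => T _; rewrite setU0. Qed.

(** The budget behind the denominator [t.+2]: at most [t] classes come from [S] and [Q], which
    leaves room for two more. *)
Lemma enlarge_classes (B : {set K}) : (#|B| <= 2)%N ->
  exists W : {set K},
    [/\ W \subset F, #|W| = t.+2, F :&: classes (S :|: Q) \subset W
      & F :&: B \subset W].
Proof.
move=> leB2.
have [||W [sW sWF cardW]] :=
    @intermediate_set _ (F :&: (classes (S :|: Q) :|: B)) F t.+2.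
- exact: subsetIl.
- rewrite cardF andbT -addn2.
  apply: leq_trans (subset_leq_card (subsetIr _ _)) _.
  apply: leq_trans (leq_card_setU _ _) (leq_add _ leB2).
  apply: leq_trans (card_classes _) (leq_trans _ cardSQ).
  exact: leq_card_setU.
by exists W; split=> //; move: sW; rewrite setIUr subUset => /andP[].
Qed.

Lemma sa_row_ge0 x : 0 <= sa_row [set x].
Proof.
have [|W [sWF cardW sW sxW]] := @enlarge_classes (cls x).
  exact: leq_trans (card_cls x) _.
rewrite (sa_row_average sWF cardW).
  by rewrite mulr_ge0 ?invr_ge0 ?ler0n // sumr_ge0 // => j _; rewrite mulr_ge0 ?ler0n.
by rewrite classesU classes1 setIUr subUset sW.
Qed.

(** On the support of [a] the row is a nonnegative combination of the tours in [W], so an inequality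
    valid for each of these tours passes to the row. Coordinates outside the support need no
    average. *)
Lemma local_inequality (a : I -> R) b (W : {set K}) :
  W \subset F -> #|W| = t.+2 -> F :&: classes (S :|: Q) \subset W ->
  (forall x, a x != 0 -> F :&: cls x \subset W) ->
  (forall j, j \in W -> b <= \sum_x a x * (x \in tr j)%:R) ->
  b * sa_row set0 <= \sum_x a x * sa_row [set x].
Proof.
move=> sWF cardW sW saW leb.
have rowx x : a x * sa_row [set x]
    = a x * (t.+2%:R^-1 * \sum_(j in W) hits j * (x \in tr j)%:R).
  have [-> | nza] := eqVneq (a x) 0; first by rewrite !mul0r.
  rewrite (sa_row_average sWF cardW).
    by under eq_bigr => j _ do rewrite sub1set.
  by rewrite classesU classes1 setIUr subUset sW saW.
under [leRHS]eq_bigr => x _.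
  rewrite rowx mulrCA mulr_sumr.
  under eq_bigr => j _ do rewrite mulrCA.
  over.
rewrite -mulr_sumr exchange_big /= (sa_row_average sWF cardW) ?setU0 //.
rewrite mulrCA ler_wpM2l ?invr_ge0 ?ler0n // mulr_sumr; apply: ler_sum => j Wj.
by rewrite sub0set mulr1 -mulr_sumr mulrC ler_wpM2l ?ler0n ?leb.
Qed.

(** The inequality is proved on [A0], where the average over [W] applies; the rest of [A] only adds
    nonnegative terms. *)
Lemma local_cut (A0 A : {set I}) (W : {set K}) :
  W \subset F -> #|W| = t.+2 -> F :&: classes (S :|: Q) \subset W ->
  A0 \subset A -> F :&: classes A0 \subset W ->
  (forall j, j \in W -> A0 :&: tr j != set0) ->
  sa_row set0 <= \sum_x (x \in A)%:R * sa_row [set x].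
Proof.
move=> sWF cardW sW sA0 sA0W A0tr.
apply: (@le_trans _ _ (\sum_x (x \in A0)%:R * sa_row [set x])); last first.
  apply: ler_sum => x _; rewrite ler_wpM2r ?sa_row_ge0 // ler_nat.
  by case: (boolP (x \in A0)) => // /(subsetP sA0) ->.
rewrite -[sa_row set0]mul1r; apply: local_inequality sWF cardW sW _ _ => [x | j Wj].
  rewrite pnatr_eq0 eqb0 negbK => A0x; apply: subset_trans sA0W.
  by rewrite setIS // -classes1 classesS // sub1set.
have /set0Pn[x] := A0tr j Wj; rewrite inE => /andP[A0x trx].
rewrite (bigD1 x) //= A0x trx mulr1 lerDl sumr_ge0 // => y _.
by rewrite mulr_ge0 ?ler0n.
Qed.

Lemma cut_inequality (A : {set I}) :
  (forall j, j \in F -> A :&: tr j != set0) ->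
  sa_row set0 <= \sum_x (x \in A)%:R * sa_row [set x].
Proof.
move=> Atr.
have cutS (A0 : {set I}) : (#|A0| <= 2)%N -> A0 \subset A ->
    (forall j, j \in F -> A0 :&: tr j != set0) ->
    sa_row set0 <= \sum_x (x \in A)%:R * sa_row [set x].
  move=> leA0 sA0 A0tr.
  have [|W [sWF cardW sW sA0W]] := @enlarge_classes (classes A0).
    exact: leq_trans (card_classes _) leA0.
  by apply: (local_cut sWF cardW sW sA0 sA0W) => j /(subsetP sWF); apply: A0tr.
have [sAD | /subsetPn[e Ae De]] := boolP (A \subset D).
  (* All edges of [A] are dashed: any admissible [W] works, with the edges of [A] whose class lies
     in [W]. *)
  have [|W [sWF cardW sW _]] := @enlarge_classes set0; first by rewrite cards0.
  apply: (@local_cut [set x in A | cls x \subset W] A W) => //.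
  - by apply/subsetP => x; rewrite inE => /andP[].
  - apply: subset_trans (subsetIr _ _) _; apply/bigcupsP => x.
    by rewrite inE => /andP[].
  - move=> j Wj; have /set0Pn[x] := Atr j (subsetP sWF j Wj).
    rewrite inE => /andP[Ax trx]; apply/set0Pn; exists x.
    (* A dashed edge on tour [j] has [j] as its only class, and [j] is in [W]. *)
    rewrite !inE Ax trx andbT /=; apply/subsetP => k clsk.
    rewrite tr_dashed ?(subsetP sAD) // in trx.
    by rewrite (card_le1_eqP (card_cls x) j k).
have [e_all | ] := boolP [forall j in F, e \in tr j].
  apply: (cutS [set e]) => [||j Fj]; rewrite ?cards1 ?sub1set //.
  apply/set0Pn; exists e; rewrite !inE eqxx /=.
  by move/forall_inP: e_all; apply.
case/forall_inPn => k Fk trke; have /set0Pn[f] := Atr k Fk.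
rewrite inE => /andP[Af trf].
apply: (cutS [set e; f]) => [||j Fj].
- by rewrite cards2; case: (_ != _).
- by rewrite subUset !sub1set Ae.
have [trje | trje] := boolP (e \in tr j); apply/set0Pn.
  by exists e; rewrite !inE eqxx.
(* A tour missing the solid edge [e] is indexed by the class of [e]; hence [j = k], and [f] was
   chosen on tour [k]. *)
exists f; rewrite !inE eqxx orbT /=.
by move: trje trke; rewrite !(tr_solid _ De) !negbK => ej ek;
  rewrite (card_le1_eqP (card_cls e) k j).
Qed.

End Row.
End TourAverages.

(** * Dicycles, and Hamiltonian dicycles crossing cuts *)

Section Dicycles.
Variable G : digraph.
Implicit Types (A : {set edge G}) (S : {set vert G}) (p : seq (edge G)).

Lemma dicycle_seq_next p e : dicycle_seq p -> e \in p -> tgt e = src (next p e).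
Proof. by case/and3P=> _ cp _ pe; apply/eqP/(next_cycle cp). Qed.

Lemma dicycle_leaves A e : dicycle A -> e \in A ->
  exists2 f, f \in A & src f = tgt e.
Proof.
case=> p dp ->; rewrite inE => pe; exists (next p e).
  by rewrite inE mem_next.
by rewrite -dicycle_seq_next.
Qed.

Lemma dicycle_src_inj A : dicycle A -> {in A &, injective (@src G)}.
Proof.
case=> p /and3P[_ _ up] -> e f; rewrite !inE.
elim: p up => //= g p IHp /andP[gp up].
rewrite !inE => /predU1P[-> | pe] /predU1P[-> | pf] // sef; last exact: IHp.
  by rewrite sef map_f in gp.
by rewrite -sef map_f in gp.
Qed.

(** Edges with equal heads have successors with equal tails, hence equal successors, and [next] is
    injective on a duplicate-free cycle. *)
Lemma dicycle_tgt_inj A : dicycle A -> {in A &, injective (@tgt G)}.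
Proof.
move=> dA e f; have srcI := dicycle_src_inj dA.
case: dA srcI => p dp -> srcI; rewrite !inE => pe pf.
rewrite !(dicycle_seq_next dp) // => /srcI nef.
have /prev_next pK : uniq p by case/and3P: dp => _ _ /map_uniq.
by apply: (can_inj pK); apply: nef; rewrite inE mem_next.
Qed.

Lemma hamiltonian_is_dicycle A : hamiltonian_dicycle A -> dicycle A.
Proof. by case=> p [dp defA _]; exists p. Qed.

(** If no edge of [A] entered [S], being outside [S] would propagate along the cycle from a vertex
    [u] outside [S] to every vertex, including [v] in [S]. *)
Lemma hamiltonian_enters A S : hamiltonian_dicycle A ->
  S != set0 -> S != [set: vert G] -> delta_in S :&: A != set0.
Proof.
case=> p [dp defA ham] /set0Pn[v Sv] nST.
have /subsetPn[u _ S'u] : ~~ ([set: vert G] \subset S) by rewrite subTset.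
apply: contraTneq Sv => noA.
have step e f : e \in p -> tgt e == src f -> src e \notin S -> src f \notin S.
  move=> pe /eqP <- S'e; apply/negP => Se.
  by move/setP/(_ e): noA; rewrite !inE S'e Se defA inE pe.
have /mapP[e pe def_u] := ham u; rewrite {}def_u in S'u.
have /mapP[f pf ->] := ham v.
case/and3P: dp => _ cp _.
(* The cycle is rotated to start at the edge leaving [u], so that the induction runs along a
   path. *)
have [i q def_q] := rot_to pe.
move: cp; rewrite -(rot_cycle i) def_q /= => pq.
have sp : {subset e :: q <= p} by move=> x; rewrite -def_q mem_rot.
have: f \in e :: q by rewrite -def_q mem_rot.
rewrite inE => /predU1P[-> // | qf].
have {pq} : path (fun e f => tgt e == src f) e q.
  by move: pq; rewrite rcons_path => /andP[].
elim: q e S'u {pe def_q} sp qf => // g q IHq e S'e sp; rewrite inE => qf /= /andP[eg gq].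
have S'g : src g \notin S by apply: step eg S'e; apply: sp; rewrite mem_head.
case/predU1P: qf => [-> // | qf]; apply: IHq gq => // x qx.
by apply: sp; rewrite inE qx orbT.
Qed.

Lemma delta_outE S : delta_out S = delta_in (~: S).
Proof. by apply/setP=> e; rewrite !inE negbK. Qed.

Lemma hamiltonian_leaves A S : hamiltonian_dicycle A ->
  S != set0 -> S != [set: vert G] -> delta_out S :&: A != set0.
Proof.
move=> hA nS0 nST; rewrite delta_outE hamiltonian_enters //.
  by rewrite -(inj_eq (can_inj (@setCK _))) setCK setC0.
by rewrite -(inj_eq (can_inj (@setCK _))) setCK setCT.
Qed.

Lemma dicycle_in_le1 A v : dicycle A -> #|delta_in [set v] :&: A| <= 1.
Proof.
move=> dA; apply/card_le1_eqP => e f; rewrite !inE.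
case/andP=> /andP[_ /eqP te] Ae /andP[/andP[_ /eqP tf] Af].
by apply: (dicycle_tgt_inj dA); rewrite // te tf.
Qed.

Lemma dicycle_out_le1 A v : dicycle A -> #|delta_out [set v] :&: A| <= 1.
Proof.
move=> dA; apply/card_le1_eqP => e f; rewrite !inE.
case/andP=> /andP[/eqP se _] Ae /andP[/andP[/eqP sf _] Af].
by apply: (dicycle_src_inj dA); rewrite // se sf.
Qed.

End Dicycles.

(** * The split digraph as an instance of the abstract family of tours *)

Section Splitting.
Variables (G : digraph) (N : nat) (C : 'I_N -> {set edge G}).
Variables (F : {set 'I_N}) (lab : vert G -> 'I_N).
Hypothesis dicycleC : forall j, dicycle (C j).
Hypothesis disjointC : forall i j, i != j -> [disjoint C i & C j].
Hypothesis coverC : \bigcup_j C j = [set: edge G].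
Hypothesis hlab : labelling C lab.
Hypothesis hdeg : forall v : vert G, indegree v <= 2 /\ outdegree v <= 2.

Notation Gn := (Gnew C lab).
Implicit Types (e : edge G) (j : 'I_N) (A : {set edge G}) (x : edge Gn).

Definition cycles_of (x : edge Gn) : {set 'I_N} :=
  [set j | (x \in Defs.image C lab (C j)) || (x \in dashed_of C lab j)].

Lemma C_inj e (i j : 'I_N) : e \in C i -> e \in C j -> i = j.
Proof.
move=> Ci Cj; apply/eqP; apply: contraTT Cj => /disjointC dij.
by rewrite (disjointFr dij).
Qed.

Lemma mem_image_inl e A :
  ((inl e : edge Gn) \in Defs.image C lab A) = (e \in A).
Proof. by apply: mem_imset; apply: inl_inj. Qed.

Lemma mem_image_inr w A :
  ((inr w : edge Gn) \in Defs.image C lab A) = false.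
Proof. by apply/imsetP=> -[]. Qed.

Lemma dashed_inl e : ((inl e : edge Gn) \in dashed C lab) = false.
Proof. by apply/imsetP=> -[]. Qed.

Lemma dashed_inr w : (inr w : edge Gn) \in dashed C lab.
Proof. exact: imset_f. Qed.

Lemma dashed_of_inl e j : ((inl e : edge Gn) \in dashed_of C lab j) = false.
Proof. by apply/imsetP=> -[]. Qed.

Lemma cycles_of_inl e j : (j \in cycles_of (inl e)) = (e \in C j).
Proof. by rewrite inE mem_image_inl dashed_of_inl orbF. Qed.

Lemma cycles_of_inr w j :
  reflect (exists e, [/\ e \in C j, tgt e = val w.1
                       & @tgt Gn (inl e) = @tgt Gn (inr w)])
    (j \in cycles_of (inr w)).
Proof.
rewrite inE mem_image_inr /dashed_of mem_imset /=; last exact: inr_inj.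
rewrite inE; apply: (iffP exists_inP) => [[e Ce /andP[/eqP te /eqP nte]] | [e [Ce te nte]]].
  by exists e.
by exists e => //; apply/andP; split; apply/eqP.
Qed.

Lemma mem_tour_solid x j : x \notin dashed C lab ->
  (x \in tour C lab j) = (j \notin cycles_of x).
Proof.
case: x => [e _ | w]; last by rewrite dashed_inr.
rewrite cycles_of_inl inE dashed_of_inl /=; apply/bigcupP/idP.
  case=> i neij; rewrite mem_image_inl => Ci.
  by apply: contra neij => Cj; rewrite (C_inj Ci Cj).
move=> C'j; have /bigcupP[i _ Ci] : e \in \bigcup_j C j by rewrite coverC.
exists i; last by rewrite mem_image_inl.
by apply: contraNneq C'j => <-.
Qed.

Lemma mem_tour_dashed x j : x \in dashed C lab ->
  (x \in tour C lab j) = (j \in cycles_of x).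
Proof.
case: x => [e | w _]; first by rewrite dashed_inl.
rewrite !inE mem_image_inr orbC /=; case: bigcupP => // -[i _].
by rewrite mem_image_inr.
Qed.

(** For a dashed edge, two classes would come from two edges of [G] entering [v] on the same side of
    the split. On the labelled side both lie in [C (lab v)]; on the other side they would join [e0]
    to make three edges entering a vertex of indegree 2. *)
Lemma card_cycles_of x : #|cycles_of x| <= 1.
Proof.
apply/card_le1_eqP => j k; case: x => [e | [w b]].
  by rewrite !cycles_of_inl => Cj Ck; apply: C_inj Ck Cj.
case: w => v hv; have [e0 C0 te0] := hlab hv.
(* The Boolean component of the head of a solid edge records whether the edge lies in
   [C (lab v)]. *)
have side e : tgt e = v ->
    @tgt Gn (inl e) = @tgt Gn (inr (exist _ v hv, b)) -> (e \in C (lab v)) = b.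
  by move=> te /(congr1 (fun y : new_vert G => (val y).2)); rewrite /= te hv.
case/cycles_of_inr=> e [Cj /= te /(side _ te) be].
case/cycles_of_inr=> f [Ck /= tf /(side _ tf) bf].
case: b be bf {side} => be bf.
  by rewrite (C_inj Cj be) (C_inj Ck bf).
case: (eqVneq e f) => [ef | nef].
  by rewrite -ef in Ck; apply: C_inj Ck Cj.
have : [set e0; e; f] \subset [set e | tgt e == v].
  by rewrite !subUset !sub1set !inE te0 te tf eqxx.
move/subset_leq_card; rewrite -/(indegree v).
have ne0e : e0 != e by apply: contraFneq be => <-.
have ne0f : e0 != f by apply: contraFneq bf => <-.
case/andP: hv => /eqP-> _.
by rewrite -setUA cardsU1 cards2 nef !inE negb_or ne0e ne0f.
Qed.

(** [g_count] sees only solid edges while [classes] also sees dashed ones; the two counts are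
    compared only when [X] has no dashed edge, and there they agree. *)
Lemma z_vecE (R : realFieldType) (Q : {set 'I_N}) t X :
  z_vec R C F lab Q t X
    = tour_vec R cycles_of (tour C lab) (dashed C lab) (F :\: Q) t X.
Proof.
rewrite /z_vec /tour_vec; case: ifP => // /eqP XD0; congr ((_ - _%:R) / _)%R.
apply: eq_card => j; rewrite !inE; congr (_ && _).
apply/set0Pn/bigcupP => [[x] | [x Xx]].
  by rewrite inE => /andP[xC Xx]; exists x => //; rewrite inE xC.
case: x Xx => [e | w] Xx.
  by rewrite cycles_of_inl => Cj; exists (inl e); rewrite inE mem_image_inl Cj.
by move/setP/(_ (inr w)): XD0; rewrite inE Xx dashed_inr inE.
Qed.

(** Every class at [x] already occurs on an edge of [G] entering the underlying vertex: a dashed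
    edge has the head of the solid edge that places it in its class. *)
Lemma card_cycles_in (x : vert Gn) : #|classes cycles_of (delta_in [set x])| <= 2.
Proof.
have [le2 _] := hdeg (val (x : new_vert G)).1; apply: leq_trans le2.
apply: leq_trans (card_bigcup_le1 (B := fun e => cycles_of (inl e)) _); last first.
  by move=> e _; apply: card_cycles_of.
apply: subset_leq_card; apply/bigcupsP => y; rewrite !inE => /andP[_ /eqP ty].
apply/subsetP => j; case: y ty => [e | w] ty Cj; apply/bigcupP.
  by exists e; rewrite // inE -ty.
have /cycles_of_inr[e [Ce te nte]] := Cj.
by exists e; rewrite ?cycles_of_inl // inE -ty -nte.
Qed.

Lemma card_cycles_out (x : vert Gn) : #|classes cycles_of (delta_out [set x])| <= 2.
Proof.
have [_ le2] := hdeg (val (x : new_vert G)).1; apply: leq_trans le2.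
apply: leq_trans (card_bigcup_le1 (B := fun e => cycles_of (inl e)) _); last first.
  by move=> e _; apply: card_cycles_of.
apply: subset_leq_card; apply/bigcupsP => y; rewrite !inE => /andP[/eqP sy _].
apply/subsetP => j; case: y sy => [e | w] sy Cj; apply/bigcupP.
  by exists e; rewrite // inE -sy.
have /cycles_of_inr[e [Ce te _]] := Cj.
(* The witness [e] for a dashed edge enters the vertex, so the edge following it on [C j] is used
   instead. *)
have [f Cf sf] := dicycle_leaves (dicycleC j) Ce.
exists f; last by rewrite cycles_of_inl.
by rewrite inE -sy sf te; case: (w) => -[].
Qed.

(* Needed because [dfj_in_ge] fails on a digraph with a single vertex. *)
Lemma Gnew_nontrivial (x : vert Gn) j :
  hamiltonian_dicycle (tour C lab j) -> [set x] != [set: vert Gn].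
Proof.
move=> [p [dp defp _]]; apply/eqP => xT.
have all_x (y : vert Gn) : y = x by apply/set1P; rewrite xT.
have allv v : v = (val (x : new_vert G)).1 by rewrite -(all_x (copy v false)).
have nosplit (v : vert G) : ~~ split_vertex v.
  apply/negP => hv.
  have := all_x (copy v true); rewrite -(all_x (copy v false)).
  by move/(congr1 (fun y : new_vert G => (val y).2)); rewrite /= hv.
have [y py] : exists y : edge Gn, y \in p.
  by case: p dp {defp} => // y p _; exists y; rewrite mem_head.
have : y \in tour C lab j by rewrite defp inE.
case: y {py} => [e | [[v hv] b]]; last by have := nosplit v; rewrite hv.
rewrite mem_tour_solid ?dashed_inl // cycles_of_inl => C'e.
have [f Cf] : exists f, f \in C j.
  by case: (dicycleC j) => -[|f q] // _ ->; exists f; rewrite inE mem_head.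
(* With a single vertex, [e] and [f] are two distinct loops there, so both degrees equal 2 and the
   vertex would have been split. *)
have nef : e != f by apply: contraNneq C'e => ->.
have /negP[] := nosplit (val (x : new_vert G)).1; rewrite /split_vertex !eqn_leq.
have [-> ->] := hdeg (val (x : new_vert G)).1; rewrite /=.
have sub (A : {set edge G}) : A = setT -> 1 < #|A|.
  by move=> ->; apply/card_gt1P; exists e, f.
by rewrite !sub //; apply/setP => g; rewrite !inE; apply/eqP; apply: allv.
Qed.

End Splitting.

(** * Verification of each family of constraints *)

Theorem theorem5 (R : realFieldType) (G : digraph) (N : nat)
    (C : 'I_N -> {set edge G}) (F : {set 'I_N}) (lab : vert G -> 'I_N)
    (hconn : strongly_connected G)
    (hdec : good_decomposition C F)
    (hdeg : forall v : vert G, indegree v <= 2 /\ outdegree v <= 2)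
    (hlab : labelling C lab)
    (htours : good_tours C lab F)
    (t : nat) (Q : {set 'I_N})
    (hQF : Q \subset F)
    (hQ : #|Q| + (t + 2) <= #|F|) :
  SA t (dfj R (Gnew C lab)) (z_vec R C F lab Q t).
Proof.
case: hdec => dC disC covC _ _ S Q' _ cardSQ a b dfjab.
have cardF : t.+2 <= #|F :\: Q|.
  by rewrite cardsD (setIidPr hQF) leq_subRL ?subset_leq_card // -addn2.
have hampF j : j \in F :\: Q -> hamiltonian_dicycle (tour C lab j).
  by rewrite inE => /andP[_ /htours].
pose cls := @cycles_of G N C lab.
have cls1 : forall x, #|cls x| <= 1 by apply: card_cycles_of.
have trS x j := @mem_tour_solid G N C lab disC covC x j.
have trD x j := @mem_tour_dashed G N C lab x j.
pose r := sa_row R cls (tour C lab) (dashed C lab) (F :\: Q) t S Q'.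
have -> : (\sum_(T in powerset Q') (-1) ^+ #|T| * z_vec R C F lab Q t (S :|: T) = r set0)%R.
  by rewrite /r sa_row_set0; apply: eq_bigr => T _; rewrite z_vecE.
have -> : (\sum_x a x * \sum_(T in powerset Q') (-1) ^+ #|T|
    * z_vec R C F lab Q t (S :|: T :|: [set x]) = \sum_x a x * r [set x])%R.
  apply: eq_bigr => x _; congr (_ * _)%R.
  by apply: eq_bigr => T _; rewrite z_vecE.
have cut A : (forall j, j \in F :\: Q -> A :&: tour C lab j != set0) ->
    (1 * r set0 <= \sum_x indic R A x * r [set x])%R.
  by move=> Atr; rewrite mul1r; apply: (cut_inequality R cls1 trS trD cardF cardSQ).
(* Any inequality valid on all tours whose support carries at most two classes. *)
have local (a' : edge (Gnew C lab) -> R) b' (B : {set 'I_N}) : #|B| <= 2 ->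
    (forall x, a' x != 0%R -> cls x \subset B) ->
    (forall j, j \in F :\: Q -> (b' <= \sum_x a' x * (x \in tour C lab j)%:R)%R) ->
    (b' * r set0 <= \sum_x a' x * r [set x])%R.
  move=> leB2 aB leb.
  have [W [sWF cardW sW sBW]] := enlarge_classes cls1 cardF cardSQ leB2.
  apply: (local_inequality cls1 trS trD sWF cardW sW) => [x /aB clsx | j Wj].
    by apply: subset_trans sBW; rewrite setIS.
  by apply: leb; apply: (subsetP sWF).
(* Upper bounds of the form [x(A) <= 1], where each tour meets [A] at most once. *)
have le_local A : #|classes cls A| <= 2 ->
    (forall j, j \in F :\: Q -> #|A :&: tour C lab j| <= 1) ->
    (-1 * r set0 <= \sum_x (- indic R A x) * r [set x])%R.
  move=> leA2 leA1; apply: local leA2 _ _ => [x | j Fj].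
    rewrite oppr_eq0 pnatr_eq0 eqb0 negbK => Ax.
    exact: (bigcup_sup x Ax).
  rewrite (eq_bigr (fun x => - (x \in A :&: tour C lab j)%:R)%R); last first.
    by move=> x _; rewrite in_setI -mulnb natrM mulNr.
  rewrite sumrN lerN2 -natr_sum lern1; apply: leq_trans (leA1 j Fj).
  by rewrite -sum1_card [leqRHS]big_mkcond; apply: leq_sum => x _; case: (x \in _).
(* The lower degree bounds are treated as cuts around singletons, which must therefore be proper
   subsets. *)
have v_nontrivial (v : vert (Gnew C lab)) : [set v] != [set: _].
  have /set0Pn[j Fj] : F :\: Q != set0 by rewrite -card_gt0 (leq_trans _ cardF).
  exact: (Gnew_nontrivial dC disC covC hdeg) (hampF j Fj).
have v_nonempty (v : vert (Gnew C lab)) : [set v] != set0.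
  by apply/set0Pn; exists v; rewrite inE.
case: a b / dfjab => [A A0 AT | A A0 AT | v | v | v | v | e | e].
- by apply: cut => j /hampF hj; apply: hamiltonian_enters.
- by apply: cut => j /hampF hj; apply: hamiltonian_leaves.
- by apply: cut => j /hampF hj; apply: hamiltonian_enters.
- apply: le_local; first exact: card_cycles_in.
  by move=> j /hampF /hamiltonian_is_dicycle; apply: dicycle_in_le1.
- by apply: cut => j /hampF hj; apply: hamiltonian_leaves.
- apply: le_local; first exact: card_cycles_out.
  by move=> j /hampF /hamiltonian_is_dicycle; apply: dicycle_out_le1.
- rewrite mul0r sumr_ge0 // => x _; apply: mulr_ge0; first exact: ler0n.
  exact: (sa_row_ge0 R cls1 trS trD cardF cardSQ).
- apply: le_local => [|j _].
    by rewrite classes1 (leq_trans (cls1 e)).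
  by rewrite -(cards1 e) subset_leq_card // subsetIl.
Qed.
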